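(* For every positive integer $n$, the Stirling numbers of the second kind $(S_2(n,k),\ k\ge 0)$ form a log-concave sequence in $k$; that is, $S_2(n,k)^2\ge S_2(n,k-1)\,S_2(n,k+1)$ for all $k\ge 1$.
   Context: $S_2(n,k)$ denotes the Stirling number of the second kind, i.e. the number of partitions of an $n$-element set into exactly $k$ non-empty blocks (so $S_2(n,k)=0$ for $k>n$). A sequence $(u(i),\ i\ge 0)$ of non-negative numbers is log-concave if $u(i)^2\ge u(i-1)u(i+1)$ for all $i\ge 1$. *)

(* Defs.v *)
From mathcomp Require Import all_boot.

Set Implicit Arguments.
Unset Strict Implicit.
Unset Printing Implicit Defensive.

(* [partition] already requires the blocks to be non-empty. *)
Definition stirling2 (n k : nat) : nat :=
  #|[set P : {set {set 'I_n}} | partition P [set: 'I_n] & #|P| == k]|.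

Definition log_concave (u : nat -> nat) : Prop :=
  forall i : nat, 1 <= i -> u i.-1 * u i.+1 <= u i ^ 2.

(* Main.v *)
Require Import Defs.
From mathcomp Require Import all_boot.
From mathcomp Require Import zify.

Set Implicit Arguments.
Unset Strict Implicit.
Unset Printing Implicit Defensive.

(** Inserting a new point [x] into a partition [P] of [A] means choosing either
    one of the blocks of [P] or the empty set, and adding [x] to the chosen set.
    Every partition of [x |: A] arises exactly once in this way
    ([insert_point_inj], [insert_point_onto]).  Hence the numbers of partitions
    obey S(n+1, k+1) = (k+1) S(n, k+1) + S(n, k) ([card_partitions_setU1]).

    The log-concavity is then an induction on n using only this recurrence.
    Log-concavity alone does not propagate, because expanding the products for
    row n+1 also produces the term S(n, k-2) S(n, k+1), to be compared with
    S(n, k-1) S(n, k); this comparison can fail for a log-concave sequence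
    with internal zeros.  The property that does propagate is the stronger
    u(i) u(j+1) <= u(i+1) u(j) for all i <= j ([stirling_rec_ratio]), of which
    log-concavity is the case i + 1 = j. *)

(** * Inserting a point into a partition *)

Lemma setD1_notin (T : finType) (x : T) (A : {set T}) :
  x \notin A -> A :\ x = A.
Proof. by move=> xA; apply/setDidPl; rewrite disjoint_sym disjoints1. Qed.

Lemma setD_set0 (T : finType) (P : {set {set T}}) (A : {set T}) :
  partition P A -> P :\ set0 = P.
Proof. by move=> partP; rewrite setD1_notin // (partition0 partP). Qed.

Lemma setU_setD (T : finType) (B A : {set T}) :
  B \subset A -> B :|: (A :\: B) = A.
Proof. by move=> BA; rewrite setDE setUIr setUCr setIT; apply/setUidPr. Qed.

Section InsertPoint.

Variables (T : finType) (x : T) (A : {set T}).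
Hypothesis xA : x \notin A.

(** Allowing [B] to be empty treats the new singleton block [[set x]] on the same
    footing as the enlargement of a block: removing [set0] from [P] is harmless. *)
Definition insert_point (PB : {set {set T}} * {set T}) : {set {set T}} :=
  (x |: PB.2) |: (PB.1 :\ PB.2).

Definition insertable : {set {set {set T}} * {set T}} :=
  [set PB | partition PB.1 A & PB.2 \in set0 |: PB.1].

Lemma notin_block (P : {set {set T}}) B :
  partition P A -> B \in P -> x \notin B.
Proof.
move=> partP BP; apply: contra xA; apply/subsetP.
exact: partitionS partP BP.
Qed.

Lemma notin_chosen PB : PB \in insertable -> x \notin PB.2.
Proof.
case: PB => P B; rewrite !inE /= => /andP[partP /orP[/eqP->|]].
  by rewrite inE.
exact: notin_block.
Qed.

Lemma new_block_notin PB : PB \in insertable -> (x |: PB.2) \notin PB.1.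
Proof.
case: PB => P B; rewrite inE => /andP[/= partP _].
by apply/negP => /(notin_block partP); rewrite setU11.
Qed.

Lemma insert_point_partition PB :
  PB \in insertable -> partition (insert_point PB) (x |: A).
Proof.
move=> PBin; have xB := notin_chosen PBin.
case: PB PBin xB => P B; rewrite !inE /= => /andP[partP PB] xB.
have partD : partition (P :\ B) (A :\: B).
  case/orP: PB => [/eqP-> | BP]; last exact: partitionD1.
  by rewrite setD0 (setD_set0 partP).
have BA : B \subset A.
  case/orP: PB => [/eqP-> | BP]; first exact: sub0set.
  exact: partitionS partP BP.
have -> : x |: A = (x |: B) :|: (A :\: B).
  by rewrite -setUA setU_setD.
apply: partitionU1 => //.
  by apply/set0Pn; exists x; rewrite setU11.
rewrite -setI_eq0; apply/eqP/setP => y; rewrite !inE.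
by case: eqP => [->|_]; rewrite ?(negPf xA) ?andbF //; case: (y \in B).
Qed.

Lemma pblock_insert_point PB :
  PB \in insertable -> pblock (insert_point PB) x = x |: PB.2.
Proof.
move=> PBin; have /and3P[_ tr _] := insert_point_partition PBin.
by apply: def_pblock => //; rewrite setU11.
Qed.

Lemma card_insert_point PB :
  PB \in insertable -> #|insert_point PB| = #|PB.1| + (PB.2 == set0).
Proof.
move=> PBin; have := new_block_notin PBin.
case: PB PBin => P B; rewrite !inE /= => /andP[partP PB] nP.
rewrite /insert_point /= cardsU1 !inE negb_and nP orbT.
case/orP: PB => [/eqP-> | BP].
  by rewrite eqxx (setD_set0 partP) addnC.
rewrite (cardsD1 B P) BP.
have [B0|_] := eqVneq B set0; last by rewrite addn0.
by move: BP; rewrite B0 (partition0 partP).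
Qed.

(** The chosen set is recovered from the block of [x], and then [P] from the
    other blocks. *)
Lemma insert_point_inj : {in insertable &, injective insert_point}.
Proof.
move=> PB QC PBin QCin eqi.
have eqB : PB.2 = QC.2.
  have : x |: PB.2 = x |: QC.2.
    by rewrite -!pblock_insert_point // eqi.
  by move/(congr1 (fun E => E :\ x)); rewrite !setU1K ?notin_chosen.
have nPB : (x |: PB.2) \notin PB.1 :\ PB.2.
  by rewrite inE negb_and new_block_notin ?orbT.
have nQC : (x |: QC.2) \notin QC.1 :\ QC.2.
  by rewrite inE negb_and new_block_notin ?orbT.
have eqD : PB.1 :\ PB.2 = QC.1 :\ QC.2.
  by rewrite -(setU1K nPB) -(setU1K nQC) -/(insert_point PB) eqi eqB.
case: PB QC PBin QCin eqB eqD {eqi nPB nQC} => P B [Q C] /=.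
rewrite !inE /= => /andP[partP PB] /andP[partQ QB] eqB; subst C => eqD.
congr pair.
have [B0|B0] := eqVneq B set0.
  by move: eqD; rewrite B0 (setD_set0 partP) (setD_set0 partQ).
move: PB QB; rewrite (negPf B0) /= => BP BQ.
by rewrite -(setD1K BP) -(setD1K BQ) eqD.
Qed.

(** The block [D] of [x] determines the preimage: the chosen set is [D :\ x], which
    has to be put back among the other blocks unless it is empty. *)
Lemma insert_point_onto Q :
  partition Q (x |: A) -> Q \in insert_point @: insertable.
Proof.
move=> partQ; have /and3P[/eqP covQ tr Q0] := partQ.
have xQ : x \in cover Q by rewrite covQ setU11.
set D := pblock Q x; have DQ : D \in Q by apply: pblock_mem.
have xD : x \in D by rewrite /D mem_pblock.
have partD := partitionD1 partQ DQ.
have DA : D \subset x |: A by exact: partitionS partQ DQ.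
have eA : (x |: A) :\: D = A :\: (D :\ x).
  apply/setP => y; rewrite !inE; case: eqP => [->|_] //=.
  by rewrite xD (negPf xA).
rewrite eA in partD.
have BA : D :\ x \subset A by rewrite subDset.
have [D0|Dn] := eqVneq (D :\ x) set0.
  rewrite D0 setD0 in partD.
  apply/imsetP; exists (Q :\ D, set0).
    by rewrite inE partD setU11.
  by rewrite /insert_point /= (setD_set0 partD) -D0 !setD1K.
have BnQ : (D :\ x) \notin Q :\ D.
  apply/negP => BQ; case/set0Pn: Dn => y yB.
  have : y \in A :\: (D :\ x).
    by rewrite -(cover_partition partD); apply/bigcupP; exists (D :\ x).
  by rewrite inE yB.
apply/imsetP; exists ((D :\ x) |: (Q :\ D), D :\ x); last first.
  by rewrite /insert_point /= setU1K // !setD1K.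
rewrite inE /= setU1r ?setU11 // andbT.
have dis : [disjoint D :\ x & A :\: (D :\ x)].
  by rewrite disjoint_sym disjoints_subset setDE subsetIr.
by have := partitionU1 partD Dn dis; rewrite setU_setD.
Qed.

End InsertPoint.

Definition partitions_of_card (T : finType) (A : {set T}) (k : nat) :=
  [set P : {set {set T}} | partition P A & #|P| == k].

(** Inserting [x] adds a block exactly when the chosen set is empty, so k+1 blocks
    come either from k+1 blocks and a choice among them, or from k blocks and
    the empty choice. *)
Lemma card_partitions_setU1 (T : finType) (x : T) (A : {set T}) k :
  x \notin A ->
  #|partitions_of_card (x |: A) k.+1| =
    k.+1 * #|partitions_of_card A k.+1| + #|partitions_of_card A k|.
Proof.
move=> xA.
have -> : partitions_of_card (x |: A) k.+1 =
    insert_point x @: [set PB in insertable A | #|insert_point x PB| == k.+1].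
  apply/setP => Q; rewrite inE; apply/andP/imsetP.
    case=> /(insert_point_onto xA) /imsetP[PB PBin ->] cardQ.
    by exists PB => //; rewrite in_set PBin.
  case=> PB; rewrite in_set => /andP[PBin cardQ] ->.
  by rewrite insert_point_partition.
rewrite card_in_imset; last first.
  by move=> PB QC; rewrite in_set => /andP[PBin _];
    rewrite in_set => /andP[QCin _]; apply: (insert_point_inj xA).
have -> : [set PB in insertable A | #|insert_point x PB| == k.+1] =
    [set PB | PB.1 \in partitions_of_card A k.+1 & PB.2 \in PB.1] :|:
    setX (partitions_of_card A k) [set set0].
  apply/setP=> PB; rewrite in_set.
  have [PBin|PBout] /= := boolP (PB \in insertable A).
    rewrite (card_insert_point xA PBin).
    case: PB PBin => P B; rewrite !inE /= => /andP[partP].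
    rewrite partP /=; have [-> _|B0] /= := eqVneq B set0.
      by rewrite (partition0 partP) andbF andbT addn1 eqSS.
    by move=> ->; rewrite addn0 andbF orbF andbT.
  case: PB PBout => P B; rewrite !inE /=; case: (partition P A) => //=.
  by rewrite negb_or => /andP[/negPf-> /negPf->]; rewrite !andbF.
rewrite cardsU.
have -> : [set PB | PB.1 \in partitions_of_card A k.+1 & PB.2 \in PB.1] :&:
    setX (partitions_of_card A k) [set set0] = set0.
  apply/setP=> -[P B]; rewrite !inE /=; apply/negP.
  by move=> /andP[/andP[/andP[partP _] BP] /andP[_ /eqP B0]];
    rewrite B0 (partition0 partP) in BP.
rewrite cards0 subn0 cardsX cards1 muln1; congr (_ + _).
rewrite -sum1_card.
rewrite (eq_bigl (fun PB => (PB.1 \in partitions_of_card A k.+1) &&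
                            (PB.2 \in PB.1))); last by move=> PB; rewrite inE.
rewrite -(pair_big_dep (fun P => P \in partitions_of_card A k.+1)
                       (fun P B => B \in P) (fun _ _ => 1)) /=.
rewrite (eq_bigr (fun=> k.+1)); first by rewrite sum_nat_const mulnC.
by move=> P; rewrite inE => /andP[_ /eqP <-]; rewrite sum1_card.
Qed.

(** * The Stirling recurrence *)

Fixpoint stirling_rec (n k : nat) : nat :=
  match n, k with
  | 0, 0 => 1
  | 0, _.+1 => 0
  | _.+1, 0 => 0
  | m.+1, l.+1 => l.+1 * stirling_rec m l.+1 + stirling_rec m l
  end.

(** Stating the count for an arbitrary finite set, not just for ['I_n], lets
    the induction remove a point without relabelling the remaining ones. *)
Lemma card_partitions_of_card (T : finType) (A : {set T}) k :
  #|partitions_of_card A k| = stirling_rec #|A| k.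
Proof.
have [n cardA] : {n | #|A| = n} by exists #|A|.
elim: n A k cardA => [|n IHn] A k cardA.
  have A0 : A = set0 by apply/eqP; rewrite -cards_eq0 cardA.
  have -> : partitions_of_card A k = if k == 0 then [set set0] else set0.
    apply/setP=> P; rewrite in_set A0 partition_set0.
    case: k => [|k] /=; rewrite ?in_set1 ?in_set0 ?cards_eq0 ?andbb //.
    by apply/negP => /andP[/eqP->]; rewrite cards0.
  by rewrite cardA; case: k => [|k] /=; rewrite ?cards1 ?cards0.
have /set0Pn[x xA] : A != set0 by rewrite -cards_eq0 cardA.
have cardA' : #|A :\ x| = n.
  by move: cardA; rewrite (cardsD1 x) xA => -[].
rewrite cardA; case: k => [|k] /=; last first.
  by rewrite -(setD1K xA) card_partitions_setU1 ?setD11 // !IHn // !cardA'.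
apply/eqP; rewrite cards_eq0; apply/eqP/setP => P; rewrite !inE cards_eq0.
apply/negP => /andP[/cover_partition + /eqP P0].
by rewrite P0 /cover big_set0 => A0; rewrite -A0 inE in xA.
Qed.

Lemma stirling2_rec n k : stirling2 n k = stirling_rec n k.
Proof.
by rewrite -[in RHS](card_ord n) -cardsT -card_partitions_of_card.
Qed.

(** * Log-concavity *)

(** The ratios u(j+1) / u(j) are non-increasing, in a division-free form that
    also excludes internal zeros.  In the expansion for row n+1 the products
    with the same index sum are compared.  For the largest sum,
    i (j+1) u(i) u(j+1) <= (i+1) j u(i+1) u(j) because i (j+1) <= (i+1) j; the
    smallest sum is the induction hypothesis itself.  For the middle sum, if
    Y, X, Z are the products
    u(i-1) u(j+1), u(i) u(j), u(i+1) u(j-1), then what is needed is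
    i X + (j+1) Y <= j X + (i+1) Z.  If i < j then Y <= X <= Z, and if i = j
    then Y = Z. *)
Lemma stirling_rec_ratio n i j : i <= j ->
  stirling_rec n i * stirling_rec n j.+1 <=
  stirling_rec n i.+1 * stirling_rec n j.
Proof.
elim: n i j => [|n IHn] [|i] [|j] //= leij.
set u := stirling_rec n in IHn *.
have h1 : u i.+1 * u j.+2 <= u i.+2 * u j.+1 by exact: IHn.
have h2 : u i * u j.+1 <= u i.+1 * u j by exact: IHn.
have hc : i.+1 * j.+2 <= i.+2 * j.+1 by lia.
have h1' := leq_mul hc h1.
have mid : i.+1 * (u i.+1 * u j.+1) + j.+2 * (u i * u j.+2) <=
           j.+1 * (u i.+1 * u j.+1) + i.+2 * (u i.+2 * u j).
  have [<-|ltij] := eqVneq i j; first by rewrite [u i * _]mulnC.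
  have hY : u i * u j.+2 <= u i.+1 * u j.+1 by apply: IHn; lia.
  have hZ : u i.+1 * u j.+1 <= u i.+2 * u j by apply: IHn; lia.
  have hY' := leq_mul (leqnn j.+2) hY.
  have hZ' := leq_mul (leqnn i.+2) hZ.
  lia.
nia.
Qed.

Theorem theorem3p2 (n : nat) (hn : 0 < n) : log_concave (stirling2 n).
Proof.
move=> [|i] // _; rewrite !stirling2_rec /= -mulnn.
exact: stirling_rec_ratio.
Qed.
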